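(* Let $G$ be a finite subgroup of $\mathrm{SO}(4)$. Then any prime divisor of the dimension of an irreducible complex representation of $G$ is $2$, $3$ or $5$.
   Context: $\mathrm{SO}(4)$ denotes the real special orthogonal group of $4\times 4$ matrices. Representations are finite-dimensional over $\mathbb{C}$. *)

(* Defs.v *)
From HB Require Import structures.
From mathcomp Require Import all_boot all_order all_algebra all_fingroup.
From mathcomp Require Import finmap mxrepresentation reals complex.

Set Implicit Arguments.
Unset Strict Implicit.
Unset Printing Implicit Defensive.

Import GRing.Theory.

Local Open Scope ring_scope.

Definition is_SO (R : comPzRingType) (n : nat) : pred 'M[R]_n :=
  fun A => (A *m A^T == 1%:M) && (\det A == 1).

Record SO (R : comPzRingType) (n : nat) : Type := SOMatrix {
  SO_mx :> 'M[R]_n;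
  _ : is_SO SO_mx
}.

HB.instance Definition _ (R : comPzRingType) (n : nat) :=
  [isSub for @SO_mx R n].
HB.instance Definition _ (R : comPzRingType) (n : nat) :=
  [Choice of SO R n by <:].

Section SOGroup.
Variables (R : comPzRingType) (n : nat).
Implicit Types A B : SO R n.

Lemma SO_mulmxT A : A *m A^T = 1%:M.
Proof. by case: A => A /= /andP[/eqP]. Qed.

Lemma SO_mulTmx A : A^T *m A = 1%:M.
Proof. exact: mulmx1C (SO_mulmxT A). Qed.

Lemma SO_det A : \det A = 1.
Proof. by case: A => A /= /andP[_ /eqP]. Qed.

Lemma is_SO1 : is_SO (1%:M : 'M[R]_n).
Proof. by rewrite /is_SO trmx1 mulmx1 det1 !eqxx. Qed.

Lemma is_SOM A B : is_SO (A *m B).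
Proof.
by rewrite /is_SO trmx_mul mulmxA -(mulmxA A) SO_mulmxT mulmx1 SO_mulmxT
  det_mulmx !SO_det mul1r !eqxx.
Qed.

Lemma is_SOT A : is_SO A^T.
Proof. by rewrite /is_SO trmxK SO_mulTmx det_tr SO_det !eqxx. Qed.

Definition SO_one : SO R n := SOMatrix is_SO1.
Definition SO_mul A B : SO R n := SOMatrix (is_SOM A B).
Definition SO_inv A : SO R n := SOMatrix (is_SOT A).

Lemma SO_mulA : associative SO_mul.
Proof. by move=> A B C; apply: val_inj; exact: mulmxA. Qed.

Lemma SO_mul1 : left_id SO_one SO_mul.
Proof. by move=> A; apply: val_inj; exact: mul1mx. Qed.

Lemma SO_mulr1 : right_id SO_one SO_mul.
Proof. by move=> A; apply: val_inj; exact: mulmx1. Qed.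

Lemma SO_mulV : left_inverse SO_one SO_inv SO_mul.
Proof. by move=> A; apply: val_inj; exact: SO_mulTmx. Qed.

Lemma SO_mulrV : right_inverse SO_one SO_inv SO_mul.
Proof. by move=> A; apply: val_inj; exact: SO_mulmxT. Qed.

HB.instance Definition _ := isGroup.Build (SO R n)
  SO_mulA SO_mul1 SO_mulr1 SO_mulV SO_mulrV.

End SOGroup.

(* [group_closed] says: contains 1 and is closed under (x, y) |-> x * y^-1. *)
Record finSubgroup (T : groupType) : Type := FinSubgroup {
  finSubgroup_fset : {fset T};
  finSubgroup_closed : group_closed (mem finSubgroup_fset)
}.

(* G as a type: its elements form a [finGroupType] with the operations of T. *)
Definition finSubgroup_sort (T : groupType) (G : finSubgroup T) : Type :=
  finSubgroup_fset G.

Coercion finSubgroup_sort : finSubgroup >-> Sortclass.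

HB.instance Definition _ (T : groupType) (G : finSubgroup T) :=
  SubFinite.on (finSubgroup_sort G).
HB.instance Definition _ (T : groupType) (G : finSubgroup T) :=
  SubChoice_isSubGroup.Build T _ (finSubgroup_sort G) (finSubgroup_closed G).

(* Main.v *)
From HB Require Import structures.
Require Import Defs.
From mathcomp Require Import all_boot all_order all_algebra all_fingroup.
From mathcomp Require Import pgroup sylow algC algnum.
From mathcomp Require Import mxrepresentation reals complex.
From mathcomp Require Import ring lra.

(** Let p >= 7 be a prime. By Ito's theorem the degree of an irreducible
representation divides the index of any normal abelian subgroup, so p cannot
divide the degree once G has a normal abelian subgroup of index prime to p. The
subgroup generated by the p-elements of G contains a Sylow p-subgroup, and it
is abelian as soon as the p-elements commute pairwise
([commuting_p_elements_index]). Everything thus rests on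
[SO4_p_elements_commute].

Identify R^4 with the quaternions. Every element of SO(4) has the form
v |-> x v conj(y) with x and y unit quaternions, and the pair (x, y) is unique
up to a common sign ([SO4_acts], [acts_sign]). So G carries two maps to the
unit quaternions, each multiplicative up to sign, and two elements of G commute
if their images under both maps do. Let s be such a map.

- If a is a unit quaternion with Re(a)^2 > 3/4, that is, if conjugation by a is
  a rotation by less than 60 degrees, then the commutator of a with any b not
  commuting with a is closer to the real axis than b: its real part is larger in
  absolute value ([qre_commutator_gt]).
- Let a = s(g) be such a quaternion, not real, and let k maximize |Re s(k)|
  among the elements whose image does not commute with a, a maximum that exists
  because G is finite. The commutator of a and s(k) must then commute with a,
  which forces Re s(k) = 0 ([comm_commutator_cases]). By maximality every s(h)
  that does not commute with a has real part 0, so s(h)^2 = -1, which is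
  impossible if h has odd order ([small_angle_commute_odd]).
- If h is a p-element with s(h) not 1 or -1, some power of s(h) is such an a:
  seven or more equally spaced points on a circle are separated by less than 60
  degrees. This is shown by Delsarte's linear programming bound, which avoids
  trigonometry ([exists_small_angle_power]).
- Hence the images of two p-elements both commute with a common nonreal
  quaternion, whose centralizer is commutative.

Ito's theorem ([mx_irreducible_dvdn_index]) is proved without characters. Let A
be normal and abelian in G, let n be the degree, e the projection on a weight
space of A and T the stabilizer of that weight. Averaging over G gives, by
Schur's lemma, that the sum over g and h in T of the commutators g h g^-1 h^-1
acts on the image of e as (|G| / n)^2. Each term depends only on the cosets of g
and h modulo A, so a sum of one term per pair of cosets acts as (|G : A| / n)^2.
A sum of group elements is an integer matrix on the functions on G, hence this
rational eigenvalue is an integer, and n divides |G : A|. *)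

Set Implicit Arguments.
Unset Strict Implicit.
Unset Printing Implicit Defensive.

Import Order.TTheory GRing.Theory Num.Theory.

Local Open Scope ring_scope.

(** * Ito's theorem: degrees divide the index of a normal abelian subgroup *)

(** The square of a / b is a rational algebraic integer, hence an integer.
Integrality only concerns its rational value, so it may be tested after
embedding rat in algC. *)
Lemma dvdn_of_integral_ratio (F : numFieldType) (p : {poly int}) (a b : nat) :
    p \is monic -> (0 < b)%N ->
    root (map_poly intr p) ((a%:R / b%:R) ^+ 2 : F) ->
  (b %| a)%N.
Proof.
move=> p_monic b_gt0 rootF; pose q : rat := (a%:R / b%:R) ^+ 2.
have ratr_p (K : numFieldType) :
    map_poly intr p = map_poly (ratr : rat -> K) (map_poly intr p).
  by rewrite -map_poly_comp; apply: eq_map_poly => z /=; rewrite ratr_int.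
have root_rat : root (map_poly intr p) q.
  rewrite -(fmorph_root (ratr : rat -> F)) -ratr_p /q rmorphXn /=.
  by rewrite fmorph_div !rmorph_nat.
have q_Aint : ratr q \in Aint.
  apply: (@root_monic_Aint (map_poly intr p)).
  - by rewrite ratr_p fmorph_root.
  - exact: monic_map.
  - by apply/polyOverP => i; rewrite coef_map /=; apply: intr_int.
have /intrP[z] := Cint_rat_Aint (Crat_rat q) q_Aint.
rewrite -[z%:~R]ratr_int => /fmorph_inj q_int.
have eq_ab : (a ^ 2)%N%:R = z%:~R * (b ^ 2)%N%:R :> rat.
  by rewrite -q_int /q expr_div_n !natrX divfK // expf_neq0 // pnatr_eq0 -lt0n.
rewrite -(@dvdn_pexp2r _ _ 2) //.
have : (a ^ 2)%N%:Z = z * (b ^ 2)%N%:Z by apply: (@intr_inj rat); rewrite intrM.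
by move/(congr1 absz); rewrite abszM !absz_nat => ->; exact: dvdn_mull.
Qed.

Section GroupSums.
Variables (F : fieldType) (gT : finGroupType) (G : {group gT}) (n : nat).
Variable rG : mx_representation F G n.

(** A matrix coefficient g |-> w rG(g) y is a function on G on which right
translation by the t i acts through permutation matrices; their sum M is an
integer matrix having k as an eigenvalue, so the characteristic polynomial of M
is the required witness. *)
Lemma sum_repr_eigenvalue_integral (I : finType) (P : pred I) (t : I -> gT)
    (k : F) (y : 'cV[F]_n) :
    (forall i, P i -> t i \in G) -> y != 0 ->
    (\sum_(i | P i) rG (t i)) *m y = k *: y ->
  exists2 p : {poly int}, p \is monic & root (map_poly intr p) k.
Proof.
move=> tG y_neq0 eigen_y.
have [j0 y_j0] : exists j, y j 0 != 0.
  apply/existsP; apply: contraR y_neq0; rewrite negb_exists => /forallP y0.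
  by apply/eqP/colP => j; rewrite mxE; apply/eqP; rewrite -[_ == _]negbK y0.
pose M : 'M[int]_#|G| := \matrix_(i, j)
  \sum_(k | P k) (enum_val i * t k == enum_val j)%g%:R.
(* The row w is the j0-th coordinate form: its value at y is nonzero, so u is
   nonzero at the unit of G. *)
pose u : 'cV[F]_#|G| := \col_i ((rG (enum_val i) *m y) j0 0).
exists (char_poly M^T); first exact: char_poly_monic.
rewrite map_char_poly -map_trmx -eigenvalue_root_char.
apply/eigenvalueP; exists u^T; last first.
  apply: contraNneq y_j0 => /rowP/(_ (enum_rank_in (group1 G) 1%g)).
  rewrite [LHS]mxE [LHS]mxE [RHS]mxE.
  by rewrite enum_rankK_in ?group1 // repr_mx1 mul1mx => ->.
have ME i j : map_mx intr M i j =
    \sum_(k | P k) ((enum_val i * t k == enum_val j)%g%:R : F).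
  by rewrite !mxE rmorph_sum; apply: eq_bigr => l _; rewrite rmorph_nat.
have uE i : u i 0 = (rG (enum_val i) *m y) j0 0 by rewrite mxE.
rewrite -trmx_mul -linearZ /=; congr (_^T); apply/colP => i.
rewrite mxE [RHS]mxE uE.
have Gi : enum_val i \in G by apply: enum_valP.
transitivity (\sum_(k | P k) (rG (enum_val i * t k)%g *m y) j0 0).
  under eq_bigr => j _ do rewrite ME mulr_suml.
  rewrite exchange_big /=; apply: eq_bigr => l Pl.
  have Gil : (enum_val i * t l)%g \in G by rewrite groupM ?tG.
  rewrite (bigD1 (enum_rank_in (group1 G) (enum_val i * t l)%g)) //=.
  rewrite uE enum_rankK_in // eqxx mul1r big1 ?addr0 // => j.
  case: (_ =P enum_val j) => [->|_ _]; last by rewrite mul0r.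
  by rewrite enum_valK_in eqxx.
under eq_bigr => l Pl do rewrite repr_mxM ?tG // -mulmxA.
rewrite -summxE -mulmx_sumr -mulmx_suml eigen_y -scalemxAr.
by rewrite mxE.
Qed.

End GroupSums.

(** Elementary matrices turn the averaging formulas below into orthogonality
relations between matrix entries. *)
Lemma mulmx_delta_mx (F : fieldType) m n (M : 'M[F]_(m, n)) (N : 'M[F]_(n, m))
    i k j l : (M *m delta_mx i k *m N) j l = M j i * N k l.
Proof.
rewrite -(mul_delta_mx (0 : 'I_1)) mulmxA -colE -mulmxA -rowE mxE big_ord1.
by rewrite !mxE.
Qed.

Lemma mxtrace_delta_mx (F : fieldType) n (M : 'M[F]_n) i k :
  \tr (delta_mx i k *m M) = M k i.
Proof.
rewrite -(mul_delta_mx (0 : 'I_1)) -mulmxA mxtrace_mulC -rowE -colE trace_mx11.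
by rewrite !mxE.
Qed.

Lemma sum_rcosets_repr (gT : finGroupType) (A T : {group gT}) (V : zmodType)
    (f : gT -> V) : A \subset T -> {in A & T, forall a g, f (a * g)%g = f g} ->
  \sum_(g in T) f g = (\sum_(C in rcosets A T) f (repr C)) *+ #|A|.
Proof.
move=> sAT f_A; rewrite -sumrMnl.
rewrite (set_partition_big _ (rcosets_partition sAT)) /=.
apply: eq_bigr => _ /rcosetsP[g Tg ->].
rewrite -(card_rcoset A g) -sumr_const; apply: eq_bigr => x /rcosetP[a Aa ->].
rewrite f_A //; have /rcosetP[b Ab ->] := mem_repr_rcoset A g.
by rewrite f_A.
Qed.

Section Ito.
Variables (F : numClosedFieldType) (gT : finGroupType) (G A : {group gT}).
Variables (n : nat) (rG : mx_representation F G n).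
Hypotheses (irrG : mx_irreducible rG) (nAG : (A <| G)%g) (abA : abelian A).

Let absG : mx_absolutely_irreducible rG.
Proof. exact: (@group_closure_closed_field F gT G) irrG. Qed.

Let n_gt0 : (0 < n)%N.
Proof. by case/andP: absG. Qed.

(** The average of the conjugates of X commutes with G, so it is scalar by
Schur's lemma; the trace gives the scalar. *)
Lemma schur_average (X : 'M[F]_n) :
  \sum_(g in G) rG g *m X *m rG g^-1%g = (#|G|%:R / n%:R * \tr X)%:M.
Proof.
set S := LHS.
have cS : centgmx rG S.
  apply/centgmxP => x Gx; rewrite mulmx_sumr mulmx_suml.
  rewrite [LHS](reindex_inj (mulgI x)) /=.
  apply: eq_big => g; rewrite groupMl // => Gg.
  by rewrite invMg !repr_mxM ?groupV // !mulmxA repr_mxKV.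
have [s defS] := is_scalar_mxP (mx_abs_irr_cent_scalar absG cS).
have trS : \tr S = #|G|%:R * \tr X.
  rewrite raddf_sum /= -sum1_card natr_sum mulr_suml; apply: eq_bigr => g Gg.
  by rewrite mxtrace_mulC mulmxA -repr_mxM ?groupV // mulVg repr_mx1 mul1mx
    mul1r.
rewrite defS; congr (_%:M); rewrite mulrAC -trS defS mxtrace_scalar.
by rewrite -[s *+ n]mulr_natr mulfK // pnatr_eq0 -lt0n.
Qed.

Section WithWeight.

Variables (v : 'rV[F]_n) (lam : gT -> F).
Hypothesis v_neq0 : v != 0.
Hypothesis v_weight : forall a, a \in A -> v *m rG a = lam a *: v.

Let sAG : {subset A <= G}. Proof. exact/subsetP/normal_sub. Qed.
Let nA g a : g \in G -> a \in A -> (a ^ g)%g \in A.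
Proof. by move=> Gg Aa; rewrite memJ_norm // (subsetP (normal_norm nAG)). Qed.

Lemma weightM a b : a \in A -> b \in A -> lam (a * b)%g = lam a * lam b.
Proof.
move=> Aa Ab; apply/eqP; rewrite -subr_eq0.
have : (lam (a * b)%g - lam a * lam b) *: v = 0.
  rewrite scalerBl -v_weight ?groupM // repr_mxM ?sAG // mulmxA v_weight //.
  by rewrite -scalemxAl v_weight // scalerA subrr.
by move/eqP; rewrite scaler_eq0 (negPf v_neq0) orbF.
Qed.

Lemma weight1 : lam 1%g = 1.
Proof.
apply/eqP; rewrite -subr_eq0.
have : (lam 1%g - 1) *: v = 0.
  by rewrite scalerBl -v_weight // repr_mx1 mulmx1 scale1r subrr.
by move/eqP; rewrite scaler_eq0 (negPf v_neq0) orbF.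
Qed.

Lemma weightV a : a \in A -> lam a^-1%g * lam a = 1.
Proof. by move=> Aa; rewrite -weightM ?groupV // mulVg weight1. Qed.

(** The projection on the lam-weight space of A. It is locked because its
scalar factor would otherwise be picked up when scalars move in products. *)
Definition weight_proj : 'M[F]_n :=
  locked (#|A|%:R^-1 *: \sum_(a in A) lam a^-1%g *: rG a).
Local Notation e := weight_proj.

Lemma weight_projE : e = #|A|%:R^-1 *: \sum_(a in A) lam a^-1%g *: rG a.
Proof. by rewrite /weight_proj -lock. Qed.

Let A_neq0 : #|A|%:R != 0 :> F.
Proof. by rewrite pnatr_eq0 -lt0n cardG_gt0. Qed.

Lemma weight_proj_neq0 : e != 0.
Proof.
suffices ve : v *m e = v.
  by apply: contraNneq v_neq0 => e0; rewrite -ve e0 mulmx0.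
rewrite weight_projE -scalemxAr mulmx_sumr.
under eq_bigr => a Aa do
  rewrite -scalemxAr v_weight // scalerA weightV // scale1r.
by rewrite sumr_const -scaler_nat scalerA mulVf ?scale1r.
Qed.

Lemma weight_projr a : a \in A -> e *m rG a = lam a *: e.
Proof.
move=> Aa; rewrite weight_projE -scalemxAl scalerA mulrC -scalerA mulmx_suml;
  congr (_ *: _).
rewrite [in RHS](reindex_inj (mulIg a)) scaler_sumr /=.
apply: eq_big => [b|b Ab]; first by rewrite groupMr.
rewrite -scalemxAl -repr_mxM ?sAG // invMg weightM ?groupV // !scalerA mulrA.
by rewrite (mulrC (lam a)) weightV ?mul1r.
Qed.

Lemma weight_projl a : a \in A -> rG a *m e = lam a *: e.
Proof.
move=> Aa; rewrite -weight_projr // weight_projE -scalemxAl -scalemxAr.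
rewrite mulmx_sumr mulmx_suml; congr (_ *: _); apply: eq_bigr => b Ab.
by rewrite -scalemxAl -scalemxAr -!repr_mxM ?sAG // (centsP abA a).
Qed.

Lemma weight_proj_idem : e *m e = e.
Proof.
rewrite {2}weight_projE -scalemxAr mulmx_sumr.
under eq_bigr => a Aa do
  rewrite -scalemxAr weight_projr // scalerA weightV // scale1r.
by rewrite sumr_const -scaler_nat scalerA mulVf ?scale1r // -weight_projE.
Qed.

Definition weight_stab : {set gT} :=
  [set g in G | [forall a in A, lam (a ^ g)%g == lam a]].

Lemma weight_stab_group_set : group_set weight_stab.
Proof.
apply/group_setP; split=> [|g h].
  by rewrite inE group1; apply/forall_inP => a _; rewrite conjg1.
rewrite !inE => /andP[Gg /forall_inP lam_g] /andP[Gh /forall_inP lam_h].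
rewrite groupM //; apply/forall_inP => a Aa.
by rewrite conjgM (eqP (lam_h _ _)) ?nA // lam_g.
Qed.
Canonical weight_stab_group := Group weight_stab_group_set.
Local Notation T := weight_stab_group.

Lemma sub_weight_stab : A \subset T.
Proof.
apply/subsetP => a Aa; rewrite inE sAG //; apply/forall_inP => b Ab.
by rewrite conjgE (centsP abA _ Ab _ Aa) mulKg.
Qed.

Let sTG : {subset T <= G}. Proof. by move=> g; rewrite inE => /andP[]. Qed.

Lemma weight_projC g : g \in T -> e *m rG g = rG g *m e.
Proof.
rewrite inE => /andP[Gg /forall_inP lam_g].
rewrite weight_projE -scalemxAl -scalemxAr mulmx_suml mulmx_sumr;
  congr (_ *: _).
rewrite [RHS](reindex_inj (conjg_inj g)) /=; apply: eq_big => [a|a Aa].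
  by rewrite memJ_norm // (subsetP (normal_norm nAG)).
rewrite -scalemxAl -scalemxAr -conjVg (eqP (lam_g _ _)) ?groupV //.
have Ga := sAG Aa; have Gag := sAG (nA Gg Aa).
by rewrite -!repr_mxM // conjgC.
Qed.

(** Two different weight spaces are in direct sum: moving some a in A with
lam (a ^ g) != lam a through rG g gives two values for the same matrix. *)
Lemma weight_proj_orthogonal g : g \in G -> g \notin T -> e *m rG g *m e = 0.
Proof.
move=> Gg; rewrite inE Gg /= negb_forall_in => /exists_inP[a Aa neq_lam].
have : (lam (a ^ g)%g - lam a) *: (e *m rG g *m e) = 0.
  have Ga := sAG Aa; have Aag := nA Gg Aa; have Gag := sAG Aag.
  have -> : (lam (a ^ g)%g - lam a) *: (e *m rG g *m e) =
      e *m rG g *m rG (a ^ g)%g *m e - e *m rG a *m rG g *m e.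
    rewrite scalerBl (weight_projr Aa) -!scalemxAl.
    by rewrite -(mulmxA _ (rG (a ^ g)%g)) (weight_projl Aag) -scalemxAr.
  by rewrite -(mulmxA e (rG g)) -(mulmxA e (rG a)) -!repr_mxM // -conjgC subrr.
by move/eqP; rewrite scaler_eq0 subr_eq0 (negPf neq_lam) => /eqP.
Qed.

Let c : F := #|G|%:R / n%:R.

(** Schur's averaging on one weight space: sandwiching the average over G
between two copies of e kills the terms outside T. The constant |G| / n
is inherited from G. *)
Lemma schur_average_weight (Y : 'M[F]_n) :
  \sum_(g in T) rG g *m (e *m Y *m e) *m rG g^-1%g = (c * \tr (Y *m e)) *: e.
Proof.
have trY : \tr (Y *m e) = \tr (e *m Y *m e).
  by rewrite [RHS]mxtrace_mulC !mulmxA weight_proj_idem mxtrace_mulC.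
rewrite trY; transitivity (e *m (c * \tr (e *m Y *m e))%:M *m e); last first.
  by rewrite mul_mx_scalar -scalemxAl weight_proj_idem.
rewrite -schur_average mulmx_sumr mulmx_suml.
rewrite [RHS](bigID (mem T)) /= [X in _ + X]big1 ?addr0; last first.
  by move=> g /andP[Gg nTg]; rewrite !mulmxA weight_proj_orthogonal ?mul0mx.
apply: eq_big => [g|g Tg].
  by apply/idP/andP => [Tg|[]//]; split; [exact: sTG|].
have TgV : g^-1%g \in T by rewrite groupV.
have -> : e *m (rG g *m (e *m Y *m e) *m rG g^-1%g) *m e
    = (e *m rG g *m e) *m Y *m (e *m rG g^-1%g *m e) by rewrite !mulmxA.
rewrite (weight_projC Tg) -(mulmxA _ e e) -(mulmxA e (rG _) e).
rewrite -(weight_projC TgV).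
by rewrite (mulmxA e e) weight_proj_idem !mulmxA.
Qed.

(** Entry by entry this is the previous lemma applied to elementary
matrices: it is the orthogonality of a character with its matrix entries. *)
Lemma sum_trace_weight :
  \sum_(h in T) \tr (rG h *m e) *: (rG h^-1%g *m e) = c *: e.
Proof.
apply/matrixP => k l; rewrite summxE.
transitivity (\sum_i (\sum_(h in T)
    rG h *m (e *m delta_mx i k *m e) *m rG h^-1%g) i l).
  under [RHS]eq_bigr => i _ do rewrite summxE.
  rewrite exchange_big /=; apply: eq_bigr => h Th.
  rewrite mxE /mxtrace mulr_suml; apply: eq_bigr => i _.
  have ThV : h^-1%g \in T by rewrite groupV.
  rewrite -mulmx_delta_mx -(weight_projC ThV) !mulmxA.
  by rewrite -(weight_projC Th).
transitivity ((c *: (e *m e)) k l); last by rewrite weight_proj_idem.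
rewrite [RHS]mxE [X in _ * X]mxE mulr_sumr; apply: eq_bigr => i _.
by rewrite schur_average_weight mxE mxtrace_delta_mx mulrA.
Qed.

(** The inner sum over g turns rG h into a multiple of e by its trace, and
the sum over h is then the previous lemma. *)
Lemma commutator_sum_weight :
  \sum_(g in T) \sum_(h in T) rG (g * h * g^-1 * h^-1)%g *m e = c ^+ 2 *: e.
Proof.
rewrite exchange_big expr2 -scalerA -sum_trace_weight scaler_sumr /=.
apply: eq_bigr => h Th; have ThV : h^-1%g \in T by rewrite groupV.
transitivity ((\sum_(g in T) rG g *m (e *m rG h *m e) *m rG g^-1%g)
    *m rG h^-1%g).
  rewrite mulmx_suml; apply: eq_bigr => g Tg.
  have TgV : g^-1%g \in T by rewrite groupV.
  rewrite weight_projC // -(mulmxA _ e e) weight_proj_idem.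
  rewrite !repr_mxM ?groupM ?sTG //.
  rewrite -!mulmxA; congr (_ *m (_ *m _)).
  by rewrite [RHS]mulmxA (weight_projC TgV) -mulmxA (weight_projC ThV).
by rewrite schur_average_weight scalerA -scalemxAl weight_projC.
Qed.

(** On the weight space a and a^-1 act by inverse scalars, wherever they
stand in a word of T. Hence commutators in T depend only on cosets of A. *)
Lemma weight_proj_commute_out u a x y :
    u \in T -> a \in A -> x \in T -> y \in T ->
  rG (u * a * x * a^-1 * y)%g *m e = rG (u * x * y)%g *m e.
Proof.
move=> Tu Aa Tx Ty; have AaV : a^-1%g \in A by rewrite groupV.
have [Gu [Gx Gy]] := (sTG Tu, (sTG Tx, sTG Ty)).
have [Ga GaV] := (sAG Aa, sAG AaV).
rewrite !repr_mxM ?groupM // -!mulmxA -(weight_projC Ty).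
rewrite (mulmxA (rG a^-1%g)) (weight_projl AaV) -scalemxAl.
rewrite -!scalemxAr (mulmxA (rG x)) -(weight_projC Tx) -mulmxA (mulmxA (rG a)).
by rewrite (weight_projl Aa) -scalemxAl -!scalemxAr scalerA weightV // scale1r.
Qed.

Lemma commutator_repr_sum_weight :
  (\sum_(CD in setX (rcosets A T) (rcosets A T))
     rG (repr CD.1 * repr CD.2 * (repr CD.1)^-1 * (repr CD.2)^-1)%g) *m e
  = (#|G : A|%g%:R / n%:R) ^+ 2 *: e.
Proof.
have Lagr : #|G|%:R = #|A|%:R * #|G : A|%g%:R :> F.
  by rewrite -natrM Lagrange // normal_sub.
apply: (scalerI (expf_neq0 2 A_neq0)); rewrite scalerA -exprMn mulrA -Lagr.
rewrite -[#|G|%:R / _]/c -commutator_sum_weight.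
rewrite (sum_rcosets_repr sub_weight_stab) => [|a g Aa Tg]; last first.
  apply: eq_bigr => h Th.
  have := @weight_proj_commute_out 1%g a (g * h * g^-1)%g h^-1%g.
  by rewrite !mul1g invMg !mulgA => -> //; rewrite ?groupM ?groupV.
rewrite expr2 -scalerA !scaler_nat; congr (_ *+ _).
rewrite (eq_bigl (fun CD => (CD.1 \in rcosets A T) && (CD.2 \in rcosets A T)));
  last by case=> C D; rewrite in_setX.
rewrite -(pair_big (mem (rcosets A T)) (mem (rcosets A T)) (fun C D =>
  rG (repr C * repr D * (repr C)^-1 * (repr D)^-1)%g)) /= mulmx_suml -sumrMnl.
apply: eq_bigr => C rC; rewrite mulmx_suml.
have Tg : repr C \in T.
  have /rcosetsP[g Tg ->] := rC.
  have /rcosetP[a Aa ->] := mem_repr_rcoset A g.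
  by rewrite groupM // (subsetP sub_weight_stab).
rewrite [RHS](sum_rcosets_repr sub_weight_stab) // => a h Aa Th.
have := @weight_proj_commute_out (repr C) a (h * (repr C)^-1 * h^-1)%g 1%g.
by rewrite !mulg1 invMg !mulgA => -> //; rewrite ?groupM ?groupV.
Qed.

Lemma weight_dvdn_index : (n %| #|G : A|%g)%N.
Proof.
have [j e_j] : exists j, col j e != 0.
  apply/existsP; apply: contraR weight_proj_neq0.
  rewrite negb_exists => /forallP e0; apply/eqP/matrixP => i j.
  by have /negPn/eqP/colP/(_ i) := e0 j; rewrite !mxE.
have tG (CD : {set gT} * {set gT}) : CD \in setX (rcosets A T) (rcosets A T) ->
  (repr CD.1 * repr CD.2 * (repr CD.1)^-1 * (repr CD.2)^-1)%g \in G.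
  case: CD => C D; rewrite in_setX /= => /andP[];
    have reprG B : B \in rcosets A T -> repr B \in G.
    case/rcosetsP=> g Tg ->; have /rcosetP[a Aa ->] := mem_repr_rcoset A g.
    by rewrite groupM ?(sAG Aa) ?(sTG Tg).
  by move=> /reprG GC /reprG GD; rewrite !groupM ?groupV.
have [|p p_monic root_p] := @sum_repr_eigenvalue_integral _ _ _ _ rG _ _ _
    ((#|G : A|%g%:R / n%:R) ^+ 2) _ tG e_j.
  by rewrite !colE mulmxA commutator_repr_sum_weight scalemxAl.
exact: dvdn_of_integral_ratio p_monic n_gt0 root_p.
Qed.

End WithWeight.

(** A simple submodule for the abelian group A is a line, which provides a
weight of A. *)
Theorem mx_irreducible_dvdn_index : (n %| #|G : A|%g)%N.
Proof.
have sAG := normal_sub nAG; pose rA := subg_repr rG sAG.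
have mod1 : mxmodule rA (1%:M : 'M_n) by apply: mxmodule1.
have nz1 : (1%:M : 'M[F]_n) != 0.
  by rewrite -mxrank_eq0 mxrank1 -lt0n.
apply: (mxsimple_exists mod1 nz1) => -[M simM _].
have rankM := mxsimple_abelian_linear (@group_closure_closed_field F gT A) abA
  simM.
have [modM nzM _] := simM; pose v := nz_row M.
have v_neq0 : v != 0 by rewrite nz_row_eq0.
have sMv : (M <= v)%MS.
  by rewrite -(geq_leqif (mxrank_leqif_sup (nz_row_sub M))) rankM rank_rV
    v_neq0.
apply: (@weight_dvdn_index v (fun a => (v *m rG a *m pinvmx v) 0 0)) => // a Aa.
rewrite -mul_scalar_mx -mx11_scalar mulmxKpV //; apply: submx_trans sMv.
by have := mxmodule_trans modM Aa (nz_row_sub M).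
Qed.

End Ito.

(** * The quaternion algebra over an ordered field *)

Record quat (R : realFieldType) : Type :=
  Quat { qre : R; qi : R; qj : R; qk : R }.

Section QuatChoice.
Variable R : realFieldType.

Definition quat_tuple (x : quat R) := (qre x, qi x, qj x, qk x).
Definition tuple_quat (t : R * R * R * R) : quat R :=
  let: (a, b, c, d) := t in Quat a b c d.

Lemma quat_tupleK : cancel quat_tuple tuple_quat. Proof. by case. Qed.

HB.instance Definition _ := Choice.copy (quat R) (can_type quat_tupleK).
End QuatChoice.

Section QuatRing.
Variable R : realFieldType.
Implicit Types (x y z : quat R) (r : R).

Definition qadd x y :=
  Quat (qre x + qre y) (qi x + qi y) (qj x + qj y) (qk x + qk y).
Definition qopp x := Quat (- qre x) (- qi x) (- qj x) (- qk x).
Definition qreal r := Quat r 0 0 0.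
Definition qmul x y := Quat
  (qre x * qre y - qi x * qi y - qj x * qj y - qk x * qk y)
  (qre x * qi y + qi x * qre y + qj x * qk y - qk x * qj y)
  (qre x * qj y - qi x * qk y + qj x * qre y + qk x * qi y)
  (qre x * qk y + qi x * qj y - qj x * qi y + qk x * qre y).

Ltac quat_ring :=
  do ?[case=> ? ? ? ?]; rewrite /qmul /qadd /qopp /qreal /=; congr Quat; ring.

Lemma qaddA : associative qadd. Proof. quat_ring. Qed.
Lemma qaddC : commutative qadd. Proof. quat_ring. Qed.
Lemma add0q : left_id (qreal 0) qadd. Proof. quat_ring. Qed.
Lemma addNq : left_inverse (qreal 0) qopp qadd. Proof. quat_ring. Qed.

HB.instance Definition _ :=
  GRing.isZmodule.Build (quat R) qaddA qaddC add0q addNq.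

Lemma qmulA : associative qmul. Proof. quat_ring. Qed.
Lemma qmul1x : left_id (qreal 1) qmul. Proof. quat_ring. Qed.
Lemma qmulx1 : right_id (qreal 1) qmul. Proof. quat_ring. Qed.
Lemma qmulDl : left_distributive qmul qadd. Proof. quat_ring. Qed.
Lemma qmulDr : right_distributive qmul qadd. Proof. quat_ring. Qed.
Lemma oneq_neq0 : qreal 1 != qreal 0.
Proof. by apply/eqP => -[] /eqP; rewrite oner_eq0. Qed.

HB.instance Definition _ := GRing.Zmodule_isNzRing.Build (quat R)
  qmulA qmul1x qmulx1 qmulDl qmulDr oneq_neq0.

End QuatRing.

Section QuatTheory.
Variable R : realFieldType.
Implicit Types (x y z a b c d : quat R) (r t : R).

Definition qconj x := Quat (qre x) (- qi x) (- qj x) (- qk x).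
Definition qnorm x := qre x ^+ 2 + qi x ^+ 2 + qj x ^+ 2 + qk x ^+ 2.

Lemma quatP x y :
  qre x = qre y -> qi x = qi y -> qj x = qj y -> qk x = qk y -> x = y.
Proof. by case: x y => ? ? ? ? [? ? ? ?] /= -> -> -> ->. Qed.

Lemma qreD x y : qre (x + y) = qre x + qre y. Proof. by []. Qed.
Lemma qreN x : qre (- x) = - qre x. Proof. by []. Qed.

Lemma qre_sum I (s : seq I) (F : I -> quat R) :
  qre (\sum_(i <- s) F i) = \sum_(i <- s) qre (F i).
Proof. exact: (big_morph _ qreD). Qed.

Lemma qnormM x y : qnorm (x * y) = qnorm x * qnorm y.
Proof. by case: x y => ? ? ? ? [? ? ? ?]; rewrite /qnorm /=; ring. Qed.

Lemma qnorm1 : qnorm 1 = 1.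
Proof. by rewrite /qnorm /=; ring. Qed.

Lemma qnorm_conj x : qnorm (qconj x) = qnorm x.
Proof. by rewrite /qnorm /=; ring. Qed.

Lemma qnormX x n : qnorm x = 1 -> qnorm (x ^+ n) = 1.
Proof.
move=> x1; elim: n => [|n IHn]; first exact: qnorm1.
by rewrite exprS qnormM x1 mul1r.
Qed.

Lemma qnorm_eq0 x : qnorm x = 0 -> x = 0.
Proof.
case: x => a b c d; rewrite /qnorm /= => N0.
have [? [? [? ?]]] : a ^+ 2 = 0 /\ b ^+ 2 = 0 /\ c ^+ 2 = 0 /\ d ^+ 2 = 0.
  by repeat split; apply/eqP; rewrite eq_le sqr_ge0 andbT;
     move: (sqr_ge0 a) (sqr_ge0 b) (sqr_ge0 c) (sqr_ge0 d); lra.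
by congr Quat; apply/eqP; rewrite -sqrf_eq0; apply/eqP.
Qed.

Lemma qmul_eq0 x y : x * y = 0 -> x = 0 \/ y = 0.
Proof.
move=> /(congr1 qnorm); rewrite qnormM {3}/qnorm /=.
rewrite expr0n !addr0 => /eqP; rewrite mulf_eq0.
by case/orP=> /eqP/qnorm_eq0; [left | right].
Qed.

Lemma qconjM x y : qconj (x * y) = qconj y * qconj x.
Proof. by case: x y => ? ? ? ? [? ? ? ?]; apply: quatP => /=; ring. Qed.

Lemma qmulxV x : qnorm x = 1 -> x * qconj x = 1.
Proof.
by case: x => a b c d; rewrite /qnorm /= => N1; apply: quatP => /=; nra.
Qed.

Lemma qmulVx x : qnorm x = 1 -> qconj x * x = 1.
Proof.
by case: x => a b c d; rewrite /qnorm /= => N1; apply: quatP => /=; nra.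
Qed.

Lemma qrealC t x : qreal t * x = x * qreal t.
Proof. by case: x => ? ? ? ?; apply: quatP => /=; ring. Qed.

Lemma qconjE x : qconj x = qreal (2 * qre x) - x.
Proof. by case: x => ? ? ? ?; apply: quatP => /=; ring. Qed.

Lemma qsqr x : x * x = qreal (2 * qre x) * x - qreal (qnorm x).
Proof. by case: x => ? ? ? ?; rewrite /qnorm; apply: quatP => /=; ring. Qed.

Definition nonreal x := [|| qi x != 0, qj x != 0 | qk x != 0].

(** The squared length of the cross product of the imaginary parts. *)
Definition cross2 x y :=
  (qj x * qk y - qk x * qj y) ^+ 2 + (qk x * qi y - qi x * qk y) ^+ 2
  + (qi x * qj y - qj x * qi y) ^+ 2.

Lemma qcommP x y :
  x * y = y * x <-> [/\ qj x * qk y = qk x * qj y,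
    qk x * qi y = qi x * qk y & qi x * qj y = qj x * qi y].
Proof.
case: x y => x0 x1 x2 x3 [y0 y1 y2 y3] /=; split=> [[_ e1 e2 e3] | [e1 e2 e3]].
  by split; lra.
by apply: quatP => /=; lra.
Qed.

Lemma cross2_gt0 x y : x * y <> y * x -> 0 < cross2 x y.
Proof.
move=> ncomm; rewrite lt_neqAle !addr_ge0 ?sqr_ge0 // andbT.
apply/negP => /eqP /esym cross0; apply: ncomm; apply/qcommP.
move: cross0; rewrite /cross2.
set p := _ - _; set q := _ - _; set r := _ - _ => sum0.
have [p0 q0 r0] : [/\ p ^+ 2 = 0, q ^+ 2 = 0 & r ^+ 2 = 0].
  by move: (sqr_ge0 p) (sqr_ge0 q) (sqr_ge0 r); split; lra.
by split; apply/eqP; rewrite -subr_eq0 -sqrf_eq0; apply/eqP.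
Qed.

Lemma qre_commutator a b :
  qre (a * b * qconj a * qconj b) = qnorm a * qnorm b - 2 * cross2 a b.
Proof. by case: a b => ? ? ? ? [? ? ? ?]; rewrite /qnorm /cross2 /=; ring. Qed.

(** With A = Re(a)^2, B = Re(b)^2 and X the squared cross product, the real
part of the commutator is 1 - 2X, where 0 < X <= (1 - A) (1 - B) by Lagrange's
identity. As 1 - A < 1/4, this exceeds (1 + B) / 2, which is at least |Re(b)|
by the arithmetic-geometric inequality. *)
Lemma qre_commutator_gt a b :
    qnorm a = 1 -> qnorm b = 1 -> 3 / 4 < qre a ^+ 2 -> a * b <> b * a ->
  qre b ^+ 2 < qre (a * b * qconj a * qconj b) ^+ 2.
Proof.
move=> Na Nb re_a /cross2_gt0 cross_gt0; rewrite qre_commutator Na Nb mulr1.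
have Lagrange : cross2 a b = (1 - qre a ^+ 2) * (1 - qre b ^+ 2)
    - (qi a * qi b + qj a * qj b + qk a * qk b) ^+ 2.
  by rewrite -{1}Na -Nb /cross2 /qnorm; ring.
have A_le1 : qre a ^+ 2 <= 1.
  by rewrite -Na /qnorm -!addrA lerDl !addr_ge0 ?sqr_ge0.
have := sqr_ge0 (qi a * qi b + qj a * qj b + qk a * qk b).
move: Lagrange (sqr_ge0 (qre b)) re_a A_le1 cross_gt0.
set D := (_ + _ + _) ^+ 2; move: D (cross2 a b) (qre a ^+ 2) (qre b ^+ 2) => D
  X A B.
move=> Lagrange B_ge0 A_gt A_le1 X_gt0 D_ge0.
have B_lt1 : B < 1.
  rewrite ltNge; apply/negP => B_ge1.
  have : 0 <= (1 - A) * (B - 1) by apply: mulr_ge0; rewrite subr_ge0.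
  by lra.
have gtX : 2 * X < (1 - B) / 2.
  have : 0 < (A - 3 / 4) * (1 - B) by apply: mulr_gt0; rewrite subr_gt0.
  by lra.
have : ((1 + B) / 2) ^+ 2 < (1 - 2 * X) ^+ 2.
  by rewrite ltr_pXn2r // ?nnegrE; lra.
by apply: le_lt_trans; rewrite -subr_ge0; have := sqr_ge0 (1 - B); lra.
Qed.

(** Quaternions commuting with a have imaginary parts proportional to that
of a. *)
Lemma nonreal_centralizer_comm a x y :
  nonreal a -> a * x = x * a -> a * y = y * a -> x * y = y * x.
Proof.
move=> nr_a /qcommP[x1 x2 x3] /qcommP[y1 y2 y3]; apply/qcommP.
(* The components of the cross product of x and y, multiplied by any component
   of a, are linear combinations of the hypotheses multiplied by components of x
   and y. *)
have mulx t := (congr1 ( *%R t) x1, (congr1 ( *%R t) x2, congr1 ( *%R t) x3)).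
have muly t := (congr1 ( *%R t) y1, (congr1 ( *%R t) y2, congr1 ( *%R t) y3)).
have [? [? ?]] := mulx (qi y); have [? [? ?]] := mulx (qj y).
have [? [? ?]] := mulx (qk y); have [? [? ?]] := muly (qi x).
have [? [? ?]] := muly (qj x); have [? [? ?]] := muly (qk x).
by case/or3P: nr_a => nz; split; apply: (mulfI nz); lra.
Qed.

(** The conjugate d of conj(a) by b commutes with a and satisfies the same
quadratic equation as a, so d is a or conj(a). In the second case b commutes
with a; in the first, a b = b conj(a), whose imaginary part says that Re(b)
times the imaginary part of a vanishes. *)
Lemma comm_commutator_cases a b :
    qnorm a = 1 -> qnorm b = 1 -> nonreal a ->
    a * (a * b * qconj a * qconj b) = a * b * qconj a * qconj b * a ->
  a * b = b * a \/ qre b = 0.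
Proof.
move=> Na Nb nr_a.
have [d dE] : exists d, d = b * qconj a * qconj b by eexists.
have -> : a * b * qconj a * qconj b = a * d by rewrite dE !mulrA.
move=> /(congr1 (fun z => qconj a * z)).
rewrite !mulrA qmulVx // !mul1r => comm_ad.
have db : d * b = b * qconj a by rewrite dE -mulrA qmulVx ?mulr1.
have Nd : qnorm d = 1 by rewrite dE !qnormM !qnorm_conj Na Nb !mulr1.
have re_d : qre d = qre a.
  rewrite -[RHS]mul1r -Nb dE; case: {+}a {+}b => ? ? ? ? [? ? ? ?].
  by rewrite /qnorm /=; ring.
have : (d - a) * (d - qconj a) = 0.
  rewrite qconjE; set r := qreal _.
  have rC x : r * x = x * r by apply: qrealC.
  have -> : (d - a) * (d - (r - a)) = (d * d - r * d) - (a * a - r * a).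
    rewrite !rC mulrBl !mulrBr comm_ad !opprB.
    rewrite [X in _ + X + _ = _]addrC [X in X + _ = _]addrA -[LHS]addrA.
    by rewrite [X in _ + X = _]addrC subrK.
  by rewrite !qsqr Nd Na re_d -/r ![r * _ - _]addrC !addrK subrr.
case/qmul_eq0 => /eqP; rewrite subr_eq0 => /eqP eq_d.
  right; have : a * b = b * qconj a by rewrite -db eq_d.
  case: (a) (b) nr_a => ? ? ? ? [? ? ? ?] /or3P nr_a /= [e0 e1 e2 e3].
  by case: nr_a => nz; apply: (mulfI nz) => /=; lra.
left; have : b * qconj a = qconj a * b by rewrite -db eq_d.
by rewrite qconjE mulrBr mulrBl qrealC => /addrI /oppr_inj.
Qed.

End QuatTheory.

(** * Finite groups of unit quaternions up to sign *)

Section Powers.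
Variable R : realFieldType.
Implicit Types (v w : quat R).

Lemma qre_exprSS v k : qnorm v = 1 ->
  qre (v ^+ k.+2) = 2 * qre v * qre (v ^+ k.+1) - qre (v ^+ k).
Proof.
move=> Nv; rewrite !exprS.
have -> : forall x, qre (v * (v * x)) = 2 * qre v * qre (v * x) - qnorm v * qre
  x.
  by case: {Nv} v => ? ? ? ? [? ? ? ?]; rewrite /qnorm /=; ring.
by rewrite Nv mul1r.
Qed.

Lemma qre_le1 v : qnorm v = 1 -> -1 <= qre v <= 1.
Proof.
move=> Nv; have : qre v ^+ 2 <= 1 by rewrite -Nv /qnorm -!addrA lerDl !addr_ge0
  ?sqr_ge0.
by move=> ?; apply/andP; split; nra.
Qed.

(** The polynomial (t - 1/2) (t + 1/2)^2 (t + 1) is the optimal one for the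
kissing number 6 of the plane: it is nonpositive on [-1, 1/2] with zeros at the
cosines of the regular hexagon other than 1, and its expansion in Chebyshev
polynomials, which evaluate to Re(v^k), has positive coefficients. *)
Lemma delsarte_expansion v : qnorm v = 1 -> let t := qre v in
  8 * ((t - 1 / 2) * (t + 1 / 2) ^+ 2 * (t + 1)) =
  qre (v ^+ 4) + 3 * qre (v ^+ 3) + 5 * qre (v ^+ 2) + 6 * qre (v ^+ 1) + 3.
Proof.
move=> Nv t; rewrite (qre_exprSS 2 Nv) (qre_exprSS 1 Nv) (qre_exprSS 0 Nv)
  expr1 expr0 -/t.
have -> : qre (1 : quat R) = 1 by [].
by field.
Qed.

Lemma sum_powers_qre w M j : w ^+ M = 1 -> w ^+ j != 1 ->
  \sum_(k < M) qre ((w ^+ k) ^+ j) = 0.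
Proof.
move=> wM wj; rewrite -qre_sum.
have : (w ^+ j - 1) * (\sum_(k < M) (w ^+ k) ^+ j) = 0.
  under eq_bigr => k _ do rewrite exprAC.
  by rewrite -subrX1 exprAC wM expr1n subrr.
case/qmul_eq0 => [/eqP|->] //.
by rewrite subr_eq0 (negPf wj).
Qed.

(** Otherwise the Delsarte polynomial is nonpositive at the real part of
every nontrivial power of w. Summing it over all M powers gives 3 M, because the
nonconstant terms of the expansion sum to zero, while the trivial power
contributes 18: this forces M <= 6. *)
Lemma exists_small_angle_power w M :
    qnorm w = 1 -> M.-primitive_root w -> (6 < M)%N ->
  exists2 k, w ^+ k != 1 & 1 / 2 < qre (w ^+ k).
Proof.
move=> Nw prim_w M_gt6.
have [/existsP[k /andP[wk re_k]]|] :=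
    boolP [exists k : 'I_M, (w ^+ k != 1) && (1 / 2 < qre (w ^+ k))].
  by exists k.
rewrite negb_exists => /forallP small; exfalso.
have wM := prim_expr_order prim_w.
have w_neq1 j : (0 < j < M)%N -> w ^+ j != 1.
  by move=> /andP[j_gt0 j_ltM]; rewrite -(prim_order_dvd prim_w) gtnNdvd.
pose f k := let t := qre (w ^+ k) in
  8 * ((t - 1 / 2) * (t + 1 / 2) ^+ 2 * (t + 1)).
have sum_f : \sum_(k < M) f k = 3 * M%:R.
  rewrite /f; under eq_bigr => k _ do rewrite delsarte_expansion ?qnormX //.
  (* Exactly four splits: the real part of a product is itself a sum, so a fifth
     split would break up a quaternion product. *)
  rewrite 4!big_split -!mulr_sumr !sum_powers_qre ?w_neq1 //;
    try by rewrite (leq_trans _ M_gt6).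
  by rewrite /= !mulr0 !add0r sumr_const card_ord mulr_natr.
have M_gt0 : (0 < M)%N by apply: leq_trans M_gt6.
have f0 : f 0%N = 18 by rewrite /f expr0 /=; field.
have f_le0 (k : 'I_M) : k != Ordinal M_gt0 -> f k <= 0.
  move=> k_neq0; have := small k; rewrite w_neq1 ?ltn_ord ?andbT ?lt0n //=.
  rewrite -leNgt /f => re_k; rewrite pmulr_rle0 //.
  have /andP[re_ge _] := qre_le1 (qnormX k Nw).
  by rewrite !mulr_le0_ge0 ?sqr_ge0 //; lra.
have : 3 * M%:R <= 18 :> R.
  rewrite -sum_f (bigD1 (Ordinal M_gt0)) //= f0 gerDl.
  by apply: sumr_le0 => k; apply: f_le0.
have : 7%:R <= M%:R :> R by rewrite ler_nat.
by lra.
Qed.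

End Powers.

Section UpToSign.
Variable R : realFieldType.
Implicit Types x y z u v a : quat R.

(** Unit quaternions modulo this relation form the rotation group SO(3). *)
Definition eqpm x y := x = y \/ x = - y.

Lemma eqpm_sym x y : eqpm x y -> eqpm y x.
Proof. by case=> ->; [left | right; rewrite opprK]. Qed.

Lemma eqpm_trans y x z : eqpm x y -> eqpm y z -> eqpm x z.
Proof.
by case=> -> [] ->; [left|right|right|left]; rewrite ?opprK.
Qed.

Lemma eqpmM x y u v : eqpm x y -> eqpm u v -> eqpm (x * u) (y * v).
Proof.
by case=> -> [] ->; [left|right|right|left]; rewrite ?mulNr ?mulrN ?opprK.
Qed.

Lemma eqpm_qre x y : eqpm x y -> qre x ^+ 2 = qre y ^+ 2.
Proof. by case=> -> //; rewrite qreN sqrrN. Qed.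

Lemma eqpm_comm a x y : eqpm x y -> a * x = x * a -> a * y = y * a.
Proof. by case=> -> //; rewrite mulrN mulNr => /oppr_inj. Qed.

Lemma eqpm_expr_even x n : eqpm (x ^+ n) 1 -> (x ^+ 2) ^+ n = 1.
Proof. by rewrite exprAC; case=> ->; rewrite ?sqrrN expr1n. Qed.

End UpToSign.

Section ProjectiveMorphism.
Variables (R : realFieldType) (gT : finGroupType) (s : gT -> quat R).
Hypothesis s_unit : forall g, qnorm (s g) = 1.
Hypothesis sM : forall g h, eqpm (s (g * h)%g) (s g * s h).

Lemma projective_neq0 g : s g <> 0.
Proof.
move=> s0; have := s_unit g; rewrite s0 /qnorm /= !expr0n !addr0 => /eqP.
by rewrite eq_sym oner_eq0.
Qed.

Lemma projective1 : eqpm (s 1%g) 1.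
Proof.
case: (sM 1%g 1%g); rewrite mulg1 => s11.
  have /qmul_eq0[/projective_neq0 //|/eqP] : s 1%g * (s 1%g - 1) = 0.
    by rewrite mulrBr mulr1 -s11 subrr.
  by rewrite subr_eq0 => /eqP; left.
have /qmul_eq0[/projective_neq0 //|/eqP] : s 1%g * (s 1%g + 1) = 0.
  by rewrite mulrDr mulr1 {3}s11 subrr.
by rewrite addr_eq0 => /eqP; right.
Qed.

Lemma projectiveX g n : eqpm (s (g ^+ n)%g) (s g ^+ n).
Proof.
elim: n => [|n IHn]; first exact: projective1.
by rewrite expgS exprS; apply: eqpm_trans (sM _ _) _; apply: eqpmM => //; left.
Qed.

Lemma projectiveV g : eqpm (s g^-1%g) (qconj (s g)).
Proof.
have := eqpm_trans (eqpm_sym (sM g g^-1%g)) _;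
  rewrite mulgV => /(_ _ projective1).
move/(eqpmM (or_introl (erefl (qconj (s g))))).
by rewrite mulrA qmulVx // mul1r mulr1.
Qed.

Lemma projective_commutator g h :
  eqpm (s (g * h * g^-1 * h^-1)%g) (s g * s h * qconj (s g) * qconj (s h)).
Proof.
apply: eqpm_trans (sM _ _) _; apply: eqpmM (projectiveV h).
apply: eqpm_trans (sM _ _) _; apply: eqpmM (projectiveV g); exact: sM.
Qed.

(** A maximality argument: if k has the largest |Re s(k)| among the elements
whose image does not commute with s(g), then the commutator of g and k has a
larger one, so its image does commute with s(g). *)
Lemma small_angle_commute g h :
  3 / 4 < qre (s g) ^+ 2 -> nonreal (s g) ->
  s g * s h = s h * s g \/ qre (s h) = 0.
Proof.
move=> small nr; case: (eqVneq (s g * s h) (s h * s g)) => [|/eqP ncomm];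
  [by left | right].
pose S := [pred k | s g * s k != s k * s g].
have Sh : S h by apply/eqP.
case: (@arg_maxP _ _ _ h S (fun k => qre (s k) ^+ 2) Sh) => k Sk max_k.
have {}max_k j : S j -> qre (s j) ^+ 2 <= qre (s k) ^+ 2 by apply: max_k.
have /eqP ncomm_k := Sk.
have comm_c : s g * s (g * k * g^-1 * k^-1)%g = s (g * k * g^-1 * k^-1)%g * s g.
  apply/eqP; apply/negPn/negP => Sc; have := max_k _ Sc.
  rewrite (eqpm_qre (projective_commutator g k)) leNgt.
  by apply/negP; rewrite negbK qre_commutator_gt.
have [//|re_k] := comm_commutator_cases (s_unit g) (s_unit k) nr
  (eqpm_comm (projective_commutator g k) comm_c).
have := max_k h Sh; rewrite re_k expr0n /= => re_h.
by apply/eqP; rewrite -sqrf_eq0 eq_le re_h sqr_ge0.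
Qed.

(** An imaginary unit quaternion squares to -1, so its odd powers are
imaginary and never 1 or -1. *)
Lemma small_angle_commute_odd g h :
    3 / 4 < qre (s g) ^+ 2 -> nonreal (s g) -> odd #[h]%g ->
  s g * s h = s h * s g.
Proof.
move=> small nr odd_h; have [//|re_h] := small_angle_commute h small nr.
have sqr_h : s h ^+ 2 = - 1.
  by rewrite expr2 qsqr s_unit re_h mulr0 mul0r add0r.
have := projectiveX h #[h]%g; rewrite expg_order => /(eqpm_trans (eqpm_sym
  projective1)).
rewrite -(odd_double_half #[h]%g) odd_h exprS -mul2n exprM sqr_h.
rewrite -signr_odd; case: odd; rewrite ?mulr1 ?mulrN1.
  by move/eqpm_qre; rewrite qreN re_h oppr0 expr0n /= expr1n => /eqP;
    rewrite oner_eq0.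
by move/eqpm_qre; rewrite re_h expr0n /= expr1n => /eqP; rewrite oner_eq0.
Qed.

Lemma nonreal_of_sqr_neq1 (x : quat R) : qnorm x = 1 -> x ^+ 2 != 1 -> nonreal
  x.
Proof.
move=> Nx; apply: contraR; rewrite !negb_or !negbK => /and3P[/eqP i0 /eqP j0
  /eqP k0].
move: Nx; rewrite /qnorm i0 j0 k0 !expr0n !addr0 expr2 => Nx.
by apply/eqP; apply: quatP; rewrite /= ?i0 ?j0 ?k0 ?(mulr0, mul0r, subr0,
  addr0).
Qed.

(** The square w of s(g) has order a power of p, because s(g)^#[g] is 1 or
-1. If w is not 1 this order is at least 7, and some power of g has an image of
small angle, with which both s(g) and s(h) commute. Squares appear because
Re(a^2) = 2 Re(a)^2 - 1, which turns 1/2 < Re(a^2) into 3/4 < Re(a)^2. *)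
Lemma projective_p_elements_commute p g h : prime p -> (6 < p)%N ->
  (p.-elt g)%g -> (p.-elt h)%g -> s g * s h = s h * s g.
Proof.
move=> p_prime p_gt6 pg ph.
have odd_elt (x : gT) : (p.-elt x)%g -> odd #[x]%g.
  have odd_p : odd p by case: (even_prime p_prime) p_gt6 => [-> //|].
  by rewrite /p_elt => /p_natP[k ->]; rewrite oddX odd_p orbT.
pose w := s g ^+ 2.
have w_ord : w ^+ #[g]%g = 1.
  apply: eqpm_expr_even; apply: eqpm_trans (eqpm_sym (projectiveX _ _)) _.
  by rewrite expg_order; apply: projective1.
have [M prim_w M_dvd] := prim_order_exists (order_gt0 g) w_ord.
have Nw : qnorm w = 1 by apply: qnormX.
have [M1|M_neq1] := eqVneq M 1%N.
  have w1 : w = 1 by have := prim_expr_order prim_w; rewrite M1 expr1.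
  have /qmul_eq0[] : (s g - 1) * (s g + 1) = 0.
    by rewrite mulrDr mulr1 mulrBl mul1r -expr2 -/w w1 addrA subrK subrr.
  - by move/eqP; rewrite subr_eq0 => /eqP ->; rewrite mul1r mulr1.
  - by move/eqP; rewrite addr_eq0 => /eqP ->; rewrite mulN1r mulrN1.
have M_gt6 : (6 < M)%N.
  apply: leq_trans p_gt6 _; apply: dvdn_leq; first exact: prim_order_gt0 prim_w.
  move: pg M_dvd; rewrite /p_elt => /p_natP[k ->].
  case/(dvdn_pfactor _ _ p_prime)=> -[|j] _ defM;
    first by rewrite defM in M_neq1.
  by rewrite defM expnS dvdn_mulr.
have [k wk re_wk] := exists_small_angle_power Nw prim_w M_gt6.
have sq_gk : s (g ^+ k)%g ^+ 2 = w ^+ k.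
  by rewrite /w exprAC; case: (projectiveX g k) => ->; rewrite ?sqrrN.
have nr : nonreal (s (g ^+ k)%g) by apply: nonreal_of_sqr_neq1;
  rewrite ?s_unit ?sq_gk.
have small : 3 / 4 < qre (s (g ^+ k)%g) ^+ 2.
  move: re_wk; rewrite -sq_gk expr2 qsqr s_unit /=; set t := qre _ => ?; nra.
by apply: (nonreal_centralizer_comm nr); apply: small_angle_commute_odd => //;
  apply: odd_elt.
Qed.

End ProjectiveMorphism.

(** * Elements of SO(4) as pairs of unit quaternions *)

Section Frames.
Variable R : rcfType.
Implicit Types a b c d u v w x y z q : quat R.

Definition q_i : quat R := Quat 0 1 0 0.
Definition q_j : quat R := Quat 0 0 1 0.
Definition q_k : quat R := Quat 0 0 0 1.

Definition qdot x y := qre x * qre y + qi x * qi y + qj x * qj y + qk x * qk y.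

Lemma qdot_mul x y u v :
  qdot (x * u * y) (x * v * y) = qnorm x * qdot u v * qnorm y.
Proof.
by case: x y u v => ? ? ? ? [? ? ? ?] [? ? ? ?] [? ? ? ?];
  rewrite /qdot /qnorm /=; ring.
Qed.

Lemma qrealM (r t : R) : qreal (r * t) = qreal r * qreal t.
Proof. by apply: quatP; rewrite /= ?(mul0r, mulr0, subr0, addr0). Qed.

Lemma qnorm_real (r : R) : qnorm (qreal r) = r ^+ 2.
Proof. by rewrite /qnorm /= !expr0n !addr0. Qed.

Lemma exists_unit_multiple z : z <> 0 -> exists r, qnorm (qreal r * z) = 1.
Proof.
move=> z_neq0; exists (Num.sqrt (qnorm z))^-1.
have Nz_ge0 : 0 <= qnorm z by rewrite !addr_ge0 ?sqr_ge0.
rewrite qnormM qnorm_real exprVn sqr_sqrtr // mulVf //.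
by apply/eqP => /qnorm_eq0.
Qed.

(** The bisector 1 + x of 1 and x is proportional to a square root of x,
except when x = -1. *)
Lemma unit_sqrt x : qnorm x = 1 -> exists y, y * y = x.
Proof.
move=> Nx; have [/eqP|/eqP nz] := eqVneq (1 + x) 0.
  rewrite addrC addr_eq0 => /eqP ->; exists q_i.
  by apply: quatP; rewrite /=; ring.
have Nz : qnorm (1 + x) = 2 * (1 + qre x).
  move: Nx; case: x {nz} => x0 x1 x2 x3; rewrite /qnorm /= => Nx; lra.
have [r Nr] := exists_unit_multiple nz; exists (qreal r * (1 + x)).
move: Nr; rewrite qnormM qnorm_real Nz => Nr.
have sqr_mul z : qreal r * z * (qreal r * z) = qreal (r ^+ 2) * (z * z).
  by rewrite expr2 qrealM -!mulrA; congr (_ * _); rewrite mulrA -qrealC mulrA.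
rewrite sqr_mul.
have -> : (1 + x) * (1 + x) = qreal (2 * (1 + qre x)) * x.
  move: Nx; case: x {nz Nz Nr} => x0 x1 x2 x3; rewrite /qnorm /= => Nx.
  by apply: quatP => /=; nra.
by rewrite mulrA -qrealM Nr mul1r.
Qed.

(** The quaternion 1 - w u intertwines u and w. It vanishes exactly when
w = - u, and then any v anticommuting with u does. The form of q is recorded
so that vectors already aligned can be kept fixed. *)
Lemma conjugate_imaginary_units u w v :
    u * u = -1 -> w * w = -1 -> qnorm v = 1 -> v * u = - u * v ->
  exists q, [/\ qnorm q = 1, q * u = w * q &
    q = v \/ exists r, q = qreal r * (1 - w * u)].
Proof.
move=> uu ww Nv vu; have [/eqP|/eqP nz] := eqVneq (1 - w * u) 0.
  rewrite subr_eq0 => /eqP wu; exists v; split; [by [] | | by left].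
  rewrite vu; congr (_ * _); rewrite -[LHS]mul1r wu -mulrA mulrN uu opprK.
  by rewrite mulr1.
have [r Nr] := exists_unit_multiple nz; exists (qreal r * (1 - w * u)).
split=> //; last by right; exists r.
rewrite mulrA -(qrealC _ w) -!mulrA; congr (_ * _).
by rewrite mulrBl mulrBr mul1r mulr1 -mulrA uu mulrA ww mulrN1 mulN1r !opprK
  addrC.
Qed.

Definition orthonormal_frame a b c d :=
  [/\ qnorm a = 1, qnorm b = 1, qnorm c = 1 & qnorm d = 1] /\
  [/\ qdot a b = 0, qdot a c = 0, qdot a d = 0, qdot b c = 0 &
      qdot b d = 0 /\ qdot c d = 0].

Lemma frame_mul x y a b c d : qnorm x = 1 -> qnorm y = 1 ->
  orthonormal_frame a b c d ->
  orthonormal_frame (x * a * y) (x * b * y) (x * c * y) (x * d * y).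
Proof.
move=> Nx Ny [[? ? ? ?] [ab ac ad bc [bd cd]]].
split; first by split; rewrite !qnormM Nx Ny ?mul1r ?mulr1.
by split=> //; try split;
   rewrite qdot_mul Nx Ny ?ab ?ac ?ad ?bc ?bd ?cd mulr0 mul0r.
Qed.

Lemma imaginary_sqr x : qnorm x = 1 -> qre x = 0 -> x * x = -1.
Proof. by move=> Nx re_x; rewrite qsqr Nx re_x mulr0 mul0r add0r. Qed.

Lemma q_ji : q_j * q_i = - q_i * q_j.
Proof. by apply: quatP => /=; ring. Qed.

Lemma frame_align_i b c d : orthonormal_frame 1 b c d ->
  exists2 q, qnorm q = 1 & q * q_i = b * q.
Proof.
move=> [[_ Nb _ _] [re_b _ _ _ _]].
have Nj : qnorm q_j = 1 by rewrite /qnorm /=; ring.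
have [||q [Nq qi_eq _]] := @conjugate_imaginary_units q_i b q_j _ _ Nj q_ji.
- by apply: quatP => /=; ring.
- by apply: imaginary_sqr => //; move: re_b; rewrite /qdot /=; lra.
- by exists q.
Qed.

(** Here q_i anticommutes with q_j, and both q_i and 1 - c q_j commute with
q_i since c is orthogonal to 1 and q_i. *)
Lemma frame_align_j c d : orthonormal_frame 1 q_i c d ->
  exists r, [/\ qnorm r = 1, r * q_j = c * r & r * q_i = q_i * r].
Proof.
move=> [[_ _ Nc _] [_ re_c _ i_c _]].
have {}re_c : qre c = 0 by move: re_c; rewrite /qdot /=; lra.
have {}i_c : qi c = 0 by move: i_c; rewrite /qdot /=; lra.
have Ni : qnorm q_i = 1 by rewrite /qnorm /=; ring.
have ij : q_i * q_j = - q_j * q_i by rewrite mulNr q_ji mulNr opprK.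
have jj : q_j * q_j = -1 by apply: quatP => /=; ring.
have cc := imaginary_sqr Nc re_c.
have [r [Nr rj r_form]] := conjugate_imaginary_units jj cc Ni ij.
exists r; split=> //; case: r_form => [-> // | [t ->]].
case: c re_c i_c {Nc cc rj} => c0 c1 c2 c3 /= -> ->.
by apply: quatP => /=; ring.
Qed.

Lemma frame_align_k d : orthonormal_frame 1 q_i q_j d -> eqpm d q_k.
Proof.
case: d => d0 d1 d2 d3 [[_ _ _ Nd] [_ _ re_d _ [i_d j_d]]].
move: Nd re_d i_d j_d; rewrite /qnorm /qdot /=.
rewrite !(mul0r, mul1r, add0r, addr0) => Nd d00 d10 d20.
move: Nd; rewrite d00 d10 d20 !expr0n !add0r => /eqP; rewrite sqrf_eq1.
by case/orP=> /eqP ->; [left | right]; apply: quatP => /=; rewrite ?oppr0.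
Qed.

(** The unit quaternions acting on both sides are transitive on orthonormal
frames up to the sign of the last vector: move a to 1, then b to q_i, then c to
q_j. *)
Lemma frame_lift a b c d : orthonormal_frame a b c d ->
  exists x y, [/\ qnorm x = 1, qnorm y = 1 &
    [/\ x * qconj y = a, x * q_i * qconj y = b, x * q_j * qconj y = c &
        eqpm d (x * q_k * qconj y)]].
Proof.
have unitK x z : qnorm x = 1 -> x * (qconj x * z) = z.
  by move=> Nx; rewrite mulrA qmulxV ?mul1r.
have unitVK x z : qnorm x = 1 -> qconj x * (x * z) = z.
  by move=> Nx; rewrite mulrA qmulVx ?mul1r.
move=> frame; have [[Na _ _ _] _] := frame.
have Nca : qnorm (qconj a) = 1 by rewrite qnorm_conj.
have := frame_mul Nca (qnorm1 R) frame; rewrite !mulr1 qmulVx // => frame1.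
have [q Nq qi_eq] := frame_align_i frame1.
have Ncq : qnorm (qconj q) = 1 by rewrite qnorm_conj.
have := frame_mul Ncq Nq frame1; rewrite mulr1 qmulVx //.
rewrite -(mulrA (qconj q) (_ * b)) -qi_eq unitVK // => frame2.
have [r [Nr rj_eq ri]] := frame_align_j frame2.
have Ncr : qnorm (qconj r) = 1 by rewrite qnorm_conj.
have := frame_mul Ncr Nr frame2; rewrite mulr1 qmulVx //.
rewrite -(mulrA (qconj r) (_ * q)) -rj_eq unitVK //.
rewrite -(mulrA (qconj r) q_i) -ri unitVK // => frame3.
have k_eq := frame_align_k frame3.
exists (a * q * r), (q * r); rewrite !qnormM Na Nq Nr !mulr1; split=> //.
rewrite qconjM; split.
- by rewrite -!mulrA unitK // qmulxV // mulr1.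
- rewrite -!mulrA (mulrA r) ri -mulrA unitK // (mulrA q) qi_eq -!mulrA.
  by rewrite qmulxV // mulr1 unitK.
- rewrite -!mulrA (mulrA r) rj_eq -!mulrA !unitK //.
  by rewrite qmulxV // mulr1.
have -> : d = a * q * r * (qconj r * (qconj q * (qconj a * d) * q) * r)
    * (qconj r * qconj q).
  by rewrite -!mulrA !unitK // qmulxV ?mulr1.
by apply: eqpmM (or_introl erefl); apply: eqpmM k_eq; left.
Qed.

End Frames.

Section Action.
Variable R : rcfType.
Implicit Types (x y z w : quat R) (v : 'cV[R]_4) (A B : 'M[R]_4).

Definition vecq v : quat R :=
  Quat (v 0 0) (v 1 0) (v 2%:R 0) (v 3%:R 0).
Definition qvec x : 'cV[R]_4 := \col_i [:: qre x; qi x; qj x; qk x]`_i.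

Lemma qvecK : cancel qvec vecq.
Proof. by case=> a b c d; rewrite /vecq !mxE. Qed.

Lemma ord4P (P : 'I_4 -> Prop) :
  P 0 -> P 1 -> P 2%:R -> P 3%:R -> forall i, P i.
Proof.
move=> P0 P1 P2 P3 [[|[|[|[|//]]]] lt_i].
- by have -> : Ordinal lt_i = 0 by apply: val_inj.
- by have -> : Ordinal lt_i = 1 by apply: val_inj.
- by have -> : Ordinal lt_i = 2%:R by apply: val_inj.
- by have -> : Ordinal lt_i = 3%:R by apply: val_inj.
Qed.

Lemma vecqK : cancel vecq qvec.
Proof. by move=> v; apply/colP; apply: ord4P; rewrite mxE. Qed.

(** With conj(y) instead of y, both factors are multiplicative in A. *)
Definition acts A x y := forall v, vecq (A *m v) = x * vecq v * qconj y.

Lemma acts_uniq A B x y : acts A x y -> acts B x y -> A = B.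
Proof.
move=> actA actB; apply/matrixP => i j.
have /(congr1 qvec) : vecq (A *m delta_mx j 0) = vecq (B *m delta_mx j 0).
  by rewrite actA actB.
by rewrite !vecqK -!colE => /colP/(_ i); rewrite !mxE.
Qed.

Lemma actsM A B x y z w :
  acts A x y -> acts B z w -> acts (A *m B) (x * z) (y * w).
Proof. by move=> actA actB v; rewrite -mulmxA actA actB qconjM !mulrA. Qed.

Lemma sum_ord4 (F : 'I_4 -> R) :
  \sum_i F i = F 0 + F 1 + F 2%:R + F 3%:R.
Proof.
rewrite !big_ord_recl big_ord0 addr0 !addrA.
by congr (F _ + F _ + F _ + F _); apply: val_inj.
Qed.

Definition acts_mx x y : 'M[R]_4 :=
  \matrix_(i, j) qvec (x * vecq (delta_mx j 0) * qconj y) i 0.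

Lemma acts_mxP x y : acts (acts_mx x y) x y.
Proof.
move=> v; apply: (can_inj qvecK); rewrite vecqK; apply/colP => i.
rewrite mxE sum_ord4 !mxE.
case: x y => ? ? ? ? [? ? ? ?]; move: i.
by apply: ord4P; rewrite /= !mxE /=; ring.
Qed.

(** Unit quaternions are squares, so the transformation is a square too. *)
Lemma det_acts_ge0 A x y :
  qnorm x = 1 -> qnorm y = 1 -> acts A x y -> 0 <= \det A.
Proof.
move=> /unit_sqrt[z <-] /unit_sqrt[w <-] actA.
rewrite (acts_uniq actA (actsM (acts_mxP z w) (acts_mxP z w))) det_mulmx.
exact: sqr_ge0.
Qed.

Lemma qdotxx x : qdot x x = qnorm x.
Proof. by rewrite /qdot /qnorm !expr2. Qed.

Lemma orthogonal_frame A : A^T *m A = 1%:M ->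
  orthonormal_frame (vecq (col 0 A)) (vecq (col 1 A))
    (vecq (col 2%:R A)) (vecq (col 3%:R A)).
Proof.
move=> ortA; have dotA i j : qdot (vecq (col i A)) (vecq (col j A)) = (i ==
  j)%:R.
  by have /matrixP/(_ i j) := ortA; rewrite !mxE sum_ord4 !mxE /qdot /= !mxE.
by rewrite /orthonormal_frame -!qdotxx !dotA.
Qed.

Lemma acts_of_basis A x y :
    x * qconj y = vecq (col 0 A) -> x * q_i R * qconj y = vecq (col 1 A) ->
    x * q_j R * qconj y = vecq (col 2%:R A) ->
    x * q_k R * qconj y = vecq (col 3%:R A) ->
  acts A x y.
Proof.
move=> A0 A1 A2 A3 v.
have -> : vecq (A *m v) = qreal (v 0 0) * vecq (col 0 A) +
   qreal (v 1 0) * vecq (col 1 A) + qreal (v 2%:R 0) * vecq (col 2%:R A) +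
   qreal (v 3%:R 0) * vecq (col 3%:R A).
  by apply: quatP; rewrite /= mxE sum_ord4 !mxE; ring.
have -> : vecq v = qreal (v 0 0) + qreal (v 1 0) * q_i R +
   qreal (v 2%:R 0) * q_j R + qreal (v 3%:R 0) * q_k R.
  by apply: quatP => /=; ring.
rewrite -A0 -A1 -A2 -A3 !mulrDr !mulrDl -!(qrealC _ x).
by rewrite !mulrA -!(qrealC _ x).
Qed.

(** The columns of A are an orthonormal frame. If the last one had the wrong
sign, then A times a reflection would act by two unit quaternions and have
determinant -1, although such an action has a nonnegative determinant. *)
Lemma SO4_acts A : A^T *m A = 1%:M -> \det A = 1 ->
  exists x y, [/\ qnorm x = 1, qnorm y = 1 & acts A x y].
Proof.
move=> /orthogonal_frame/frame_lift[x [y [Nx Ny [A0 A1 A2 A3]]]] detA.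
exists x, y; split=> //; case: A3 => A3; first exact: acts_of_basis.
pose d : 'rV[R]_4 := \row_j (if j == 3%:R then -1 else 1).
have act_reflected : acts (A *m diag_mx d) x y.
  have colE j : vecq (col j (A *m diag_mx d)) = qreal (d 0 j) * vecq (col j A).
    by rewrite mul_mx_diag; apply: quatP; rewrite /= !mxE; ring.
  apply: acts_of_basis; rewrite colE mxE /= ?mul1r //.
  by rewrite A3; apply: quatP => /=; ring.
have := det_acts_ge0 Nx Ny act_reflected.
rewrite det_mulmx detA mul1r det_diag; have -> : \prod_i d 0 i = -1.
  by rewrite !big_ord_recl big_ord0 !mxE /= !mul1r mulr1.
by rewrite oppr_ge0 lt_geF ?ltr01.
Qed.

(** Taking z = 1 gives y = conj(x), so x is central, hence real. *)
Lemma acts1_sign x y :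
  qnorm x = 1 -> (forall z, x * z * y = z) -> x = 1 \/ x = -1.
Proof.
move=> Nx xzy.
have xy1 : x * y = 1 by rewrite -[RHS](xzy 1) mulr1.
have y_eq : y = qconj x by rewrite -[RHS]mulr1 -xy1 mulrA qmulVx ?mul1r.
have xC z : x * z = z * x.
  by rewrite -{2}(xzy z) y_eq -!mulrA qmulVx ?mulr1.
have /qcommP[_ xk xj] := xC (q_i R); have /qcommP[_ _ xi] := xC (q_j R).
move: Nx xi xj xk; rewrite /qnorm /=; case: x {xzy xy1 y_eq xC} => x0 x1 x2 x3
  /=.
rewrite !(mulr0, mulr1) => Nx x10 x30 x20; move: Nx.
rewrite x10 -x30 x20 !expr0n !addr0 => /eqP; rewrite sqrf_eq1.
by case/orP=> /eqP ->; [left | right]; apply: quatP => /=; rewrite ?oppr0.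
Qed.

Lemma acts_sign A x y z w :
  qnorm x = 1 -> qnorm y = 1 -> qnorm z = 1 -> qnorm w = 1 ->
  acts A x y -> acts A z w -> eqpm x z /\ eqpm y w.
Proof.
move=> Nx Ny Nz Nw actx actz.
have xz u : qconj z * x * u * (qconj y * w) = u.
  have := actx (qvec u); rewrite actz qvecK => e.
  by rewrite -!mulrA (mulrA u) (mulrA x) (mulrA x) -e -!mulrA qmulVx // mulr1
    mulrA qmulVx ?mul1r.
have Nzx : qnorm (qconj z * x) = 1 by rewrite qnormM qnorm_conj Nz Nx mulr1.
have zx : x = z * (qconj z * x) by rewrite mulrA qmulxV ?mul1r.
have yw : w = y * (qconj y * w) by rewrite mulrA qmulxV ?mul1r.
have xz1 := xz 1; move: xz1; rewrite mulr1.
case: (acts1_sign Nzx xz) => zx1; rewrite zx1 ?mul1r ?mulN1r => yw1.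
  by split; left; [rewrite zx zx1 mulr1 | rewrite yw yw1 mulr1].
by split; right; [rewrite zx zx1 mulrN1 | rewrite yw -[_ * w]opprK yw1 mulrN1
  opprK].
Qed.

End Action.

Section FiniteSubgroup.
Variables (R : rcfType) (gT : finGroupType) (f : gT -> 'M[R]_4).
Hypothesis f_orth : forall g, (f g)^T *m f g = 1%:M.
Hypothesis f_det : forall g, \det (f g) = 1.
Hypothesis fM : forall g h, f (g * h)%g = f g *m f h.

(** Both quaternion factors of f are multiplicative up to sign, since the
factors of a rotation are unique up to sign. *)
Lemma SO4_p_elements_commute p g h : prime p -> (6 < p)%N ->
  (p.-elt g)%g -> (p.-elt h)%g -> f g *m f h = f h *m f g.
Proof.
move=> p_prime p_gt6 pg ph.
have lift k := SO4_acts (f_orth k) (f_det k).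
have [s /fin_all_exists[t act]] := fin_all_exists lift.
have sN k : qnorm (s k) = 1 by case: (act k).
have tN k : qnorm (t k) = 1 by case: (act k).
have {}act k : acts (f k) (s k) (t k) by case: (act k).
have stM k l : eqpm (s (k * l)%g) (s k * s l) /\ eqpm (t (k * l)%g) (t k * t l).
  apply: (@acts_sign _ (f (k * l)%g)) => //; rewrite ?qnormM ?sN ?tN ?mulr1 //.
  by rewrite fM; apply: actsM.
have sC := projective_p_elements_commute sN (fun k l => (stM k l).1) p_prime
  p_gt6 pg ph.
have tC := projective_p_elements_commute tN (fun k l => (stM k l).2) p_prime
  p_gt6 pg ph.
apply: acts_uniq (actsM (act g) (act h)) _; rewrite sC tC; exact: actsM.
Qed.

End FiniteSubgroup.

(** * Finite subgroups of SO(4) *)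

Local Close Scope ring_scope.

(** The subgroup generated by all p-elements is normal and contains the Sylow
p-subgroups. *)
Lemma commuting_p_elements_index (gT : finGroupType) (G : {group gT}) p :
    prime p ->
    {in G &, forall g h, (p.-elt g)%g -> (p.-elt h)%g -> commute g h} ->
  exists A : {group gT}, [/\ A <| G, abelian A & ~~ (p %| #|G : A|)]%g.
Proof.
move=> p_prime p_comm; pose A := <<[set g in G | (p.-elt g)%g]>>%G.
exists A; split.
- rewrite /normal gen_subG; apply/andP; split.
    by apply/subsetP => g; rewrite inE => /andP[].
  apply: norms_gen; apply/subsetP => g Gg; rewrite inE.
  apply/subsetP => _ /imsetP[h + ->]; rewrite !inE => /andP[Gh ph].
  by rewrite groupJ // p_eltJ.
- rewrite abelian_gen abelianE; apply/subsetP => g; rewrite inE => /andP[Gg pg].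
  by apply/centP => h; rewrite inE => /andP[Gh ph]; apply: p_comm.
have [P sylP] := Sylow_exists p G.
have sPA : P \subset A.
  apply/subsetP => g Pg; apply: mem_gen; rewrite inE.
  rewrite (subsetP (pHall_sub sylP)) //=.
  exact: mem_p_elt (pHall_pgroup sylP) Pg.
have sAG : A \subset G by rewrite gen_subG; apply/subsetP => g;
  rewrite inE => /andP[].
have : p^'.-nat #|G : P|%g by case/and3P: sylP.
move=> p'GP; rewrite -p'natE //; apply: pnat_dvd p'GP.
exact: indexgS.
Qed.

Theorem theorem11 (R : realType) (G : finSubgroup (SO R 4))
    (n : nat) (rho : mx_representation R[i]%C [set: G] n)
    (irr_rho : mx_irreducible rho)
    (p : nat) (p_prime : prime p) (p_dvd : (p %| n)%N) :
  p = 2 \/ p = 3 \/ p = 5.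
Proof.
have [p_le6 | p_gt6] := leqP p 6.
  move: p p_prime p_le6 {p_dvd}; case=> [|[|[|[|[|[|[|//]]]]]]] //.
  - by left.
  - by right; left.
  - by right; right.
pose f (g : G) : 'M[R]_4 := SO_mx (val g).
have f_orth g : ((f g)^T *m f g = 1%:M)%R by apply: SO_mulTmx.
have f_det g : (\det (f g) = 1)%R by apply: SO_det.
have fM g h : (f (g * h)%g = f g *m f h)%R by [].
have p_comm (g h : G) : (p.-elt g)%g -> (p.-elt h)%g -> commute g h.
  move=> pg ph; do 2!apply: val_inj.
  exact: (SO4_p_elements_commute f_orth f_det fM p_prime).
have [A [nAG abA /negP[]]] := @commuting_p_elements_index _ [set: G] p p_prime
  (fun g h _ _ => p_comm g h).
exact: dvdn_trans p_dvd (mx_irreducible_dvdn_index irr_rho nAG abA).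
Qed.
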